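(* Let $s\ge1$ and $r$ be integers with $0\le r<2s-2$. There is a constant $c(r)>0$, depending only on $r$, such that for each $n\ge1$ there exist a collection $Y_s$ and a function $F\in C^r\cap\Delta^{(1)}(Y_s)$ such that $$E_n^{(1)}(F,Y_s)>n\,\frac{c(r)}{n^r}\,\omega_2\left(F^{(r)},\frac1n\right).$$ Hence, for every $A>0$ and $N>0$, there exist $n>N$, a collection $Y_s$ and a function $F\in C^r\cap\Delta^{(1)}(Y_s)$ such that $$E_n^{(1)}(F,Y_s)>\frac A{n^r}\,\omega_2\left(F^{(r)},\frac1n\right).$$
   Context: $C=C^0$ is the space of $2\pi$-periodic continuous functions $f:\mathbb R\to\mathbb R$ with the norm $\|f\|=\max_{x\in\mathbb R}|f(x)|$; for $r\in\mathbb N$, $C^r$ is the subspace of $r$ times continuously differentiable functions in $C$. A collection $Y_s=\{y_i\}_{i\in\mathbb Z}$, $s\in\mathbb N$, consists of real points with $y_i<y_{i+1}$ and $y_{i+2s}=y_i+2\pi$ for all $i\in\mathbb Z$. $\Delta^{(1)}(Y_s)$ is the set of $f\in C$ such that $(-1)^{i-1}f$ is nondecreasing on $[y_{i-1},y_i]$ for every $i\in\mathbb Z$. For $f\in\Delta^{(1)}(Y_s)$ and $n\ge1$, $E_n^{(1)}(f,Y_s)=\inf\|f-T_n\|$, the infimum being over all trigonometric polynomials $T_n$ of degree $<n$ that belong to $\Delta^{(1)}(Y_s)$. For $g\in C$ and $k\ge1$, $\omega_k(g,t)=\sup_{0<h\le t}\|\Delta_h^k(g,\cdot)\|$ is the $k$th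 modulus of smoothness, where $\Delta_h^k(g,x)=\sum_{i=0}^k(-1)^i\binom ki g(x+ih)$. *)

(* Defs.v *)
From mathcomp Require Import all_boot all_order all_algebra.
From mathcomp Require Import all_classical all_reals all_analysis.

Set Implicit Arguments.
Unset Strict Implicit.
Unset Printing Implicit Defensive.

Import Order.TTheory GRing.Theory Num.Theory.
Import numFieldNormedType.Exports.

Local Open Scope classical_set_scope.
Local Open Scope ring_scope.

Section comonotone_approximation.
Context {R : realType}.
Implicit Types (f g T : R -> R) (Y : int -> R).

Definition C0_2pi f : Prop := continuous f /\ periodic f (pi *+ 2).

Definition Cr_2pi (r : nat) f : Prop :=
  [/\ C0_2pi f,
      forall (k : nat) (x : R), (k < r)%N -> derivable (derive1n k f) x 1 &
      continuous (derive1n r f)].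

(* On [C0_2pi] the supremum is a maximum, by periodicity and compactness. *)
Definition max_norm f : R := sup [set `|f x| | x in [set: R]].

Definition collection (s : nat) Y : Prop :=
  forall i : int, Y i < Y (i + 1) /\ Y (i + (2 * s)%:Z) = Y i + pi *+ 2.

Definition Delta1 Y : set (R -> R) :=
  [set f | C0_2pi f /\
    forall i : int,
      {in `[Y (i - 1), Y i] &,
        {homo (fun x => (-1) ^ (i - 1) * f x) : x y / x <= y}}].

(* Trigonometric polynomials of degree strictly less than [n]. *)
Definition trig_poly (n : nat) : set (R -> R) :=
  [set T | exists a b : nat -> R, forall x : R,
    T x = \sum_(k < n) (a k * cos (k%:R * x) + b k * sin (k%:R * x))].

(* For [1 <= n] and [f] in [C0_2pi] this is the infimum of a nonempty set
   (constants are admissible) bounded below by [0]. *)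
Definition E1 (n : nat) f Y : R :=
  inf [set max_norm (f \- T) | T in trig_poly n `&` Delta1 Y].

Definition fwd_diff (k : nat) (h : R) g : R -> R :=
  fun x => \sum_(i < k.+1) (-1) ^+ i * 'C(k, i)%:R * g (x + i%:R * h).

Definition omega (k : nat) g (t : R) : R :=
  sup [set max_norm (fwd_diff k h g) | h in [set h : R | 0 < h <= t]].

End comonotone_approximation.

(* Main.v *)
Require Import Defs.
From mathcomp Require Import all_boot all_order all_algebra.
From mathcomp Require Import all_classical all_reals all_analysis.
From mathcomp Require Import ring lra zify.
Import Order.TTheory GRing.Theory Num.Theory.
Import numFieldNormedType.Exports.

Local Open Scope classical_set_scope.
Local Open Scope ring_scope.

(** Why the theorem holds. If [T] is comonotone with the collection, then its derivative
    vanishes at every point of the collection. Crowd at least [r + 1] of the [2s] points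
    of a period into a short interval [[0, e]], which is possible since [r < 2s - 2]: by
    Rolle's theorem ([derivative_chain_rolle]) the derivative of order [r + 1] of [T] has
    a zero there. Now let [F0(x) = sin (a x) ^ (r + 1)], a trigonometric polynomial that
    depends on [r] alone and whose derivative of order [r + 1] is bounded below by some
    [c > 0] near [0]. Bernstein's inequality ([bernstein]), applied [r + 1] times to
    [F0 - T], whose degree is [O(n)], shows that [F0] is at distance at least
    [const / n ^ (r + 1)] from every comonotone [T] of degree less than [n]
    ([cluster_lower_bound]). As [F0] is smooth, the second modulus of smoothness of its
    [r]th derivative at [1 / n] is [O(1 / n ^ 2)], so [n / n ^ r] times this modulus is at
    most of the same order [1 / n ^ (r + 1)].

    Such an [F0] need not be comonotone with the collection: it does not turn at each point
    of the cluster. It is therefore made constant near [0] by inserting the soft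
    threshold [sign t * max (|t| - e) 0] between the sine and the power
    ([flat_power]). On the cluster the result satisfies any monotonicity requirement, and
    elsewhere it has the monotonicity of [F0]. The threshold raised to the power
    [r + 1] is still [r] times continuously differentiable, and as [e] tends to [0] the
    derivatives up to order [r] converge uniformly ([flat_power_chain]). Since [e] may
    be chosen after [n], this perturbation is negligible in both bounds.

    The parity of [r] decides how the remaining points are placed. If [r] is
    even, then [F0] increases through [0], so the cluster must have an even number of points;
    with [a = 1] the two other extrema of [sin x ^ (r + 1)] in a period complete the collection.
    If [r] is odd, then [F0] has a minimum at [0] and the cluster has [2s - 1] points; with
    [a = 1/2] the only other extremum is [pi].

    Bernstein's inequality is proved by a discrete convolution: the average of [T (x + t)]
    against [2 sin (n t) F(t)], where [F] is the Fejer kernel, over [3 n] equidistant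
    values of [t] is [T'(x)] ([trig_poly_derive_mean]), and [F] is nonnegative. *)

Set Implicit Arguments.
Unset Strict Implicit.

(** * Chains of derivatives *)

Section derivative_chains.
Context {R : realType}.
Implicit Types (f g T : R -> R) (D : nat -> R -> R).

(** A family of candidate derivatives, instead of the iterates [derive1n]: sums,
    products and rescalings of chains are built level by level, and
    [derivative_chain_derive1n] identifies the iterates afterwards. *)
Definition derivative_chain (k : nat) D : Prop :=
  forall (j : nat) (x : R), (j < k)%N -> is_derive x 1 (D j) (D j.+1 x).

Lemma derivative_chain_derive1n k D j :
  derivative_chain k D -> (j <= k)%N -> derive1n j (D 0%N) = D j.
Proof.
move=> chD; elim: j => [//|j IH] jk.
rewrite derive1nS IH 1?ltnW//; apply/funext => x.
by rewrite derive1E; case: (chD j x jk).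
Qed.

Lemma derivative_chain_derivable k D j x :
  derivative_chain k D -> (j < k)%N -> derivable (D j) x 1.
Proof. by move=> chD jk; case: (chD j x jk). Qed.

Lemma derivative_chain_derive1n_derivable k D j x : derivative_chain k D -> (j < k)%N ->
  derivable (derive1n j (D 0%N)) x 1.
Proof.
move=> chD jk; rewrite (derivative_chain_derive1n chD (ltnW jk)).
exact: derivative_chain_derivable chD jk.
Qed.

Lemma is_derive_continuous f (x df : R) :
  is_derive x 1 f df -> {for x, continuous f}.
Proof. by move=> h; apply: differentiable_continuous; apply/derivable1_diffP; case: h. Qed.

Lemma continuous_derivative_chain k D j : derivative_chain k D ->
  continuous (D k) -> (j <= k)%N -> continuous (D j).
Proof.
move=> chD cD jk; move: jk cD; rewrite leq_eqVlt => /orP[/eqP->//|jk _ x].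
exact: is_derive_continuous (chD j x jk).
Qed.

Lemma is_derive_comp_scale f (a x df : R) :
  is_derive (a * x) 1 f df -> is_derive x 1 (fun y => f (a * y)) (a * df).
Proof.
move=> h; have h2 : is_derive x 1 (fun y => a * y) a.
  by apply: is_derive_eq; rewrite /GRing.scale /= mulr1.
have := @is_derive1_comp R f (fun y => a * y) x df a h h2.
by rewrite mulrC.
Qed.

Lemma derivative_chain_scale k D (a : R) : derivative_chain k D ->
  derivative_chain k (fun j x => a ^+ j * D j (a * x)).
Proof.
move=> chD j x jk; have h := is_derive_comp_scale (chD j (a * x) jk).
have h2 := is_deriveZ (a ^+ j) h.
by apply: is_derive_eq; rewrite exprS /GRing.scale /=; ring.
Qed.

End derivative_chains.

(** * The algebra of trigonometric polynomials *)

Section trigonometric_polynomials.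
Context {R : realType}.
Implicit Types (f g T : R -> R).

Lemma trig_polyD n f g : trig_poly n f -> trig_poly n g ->
  trig_poly n (fun x => f x + g x).
Proof.
move=> [a [b hf]] [a' [b' hg]].
exists (fun k => a k + a' k), (fun k => b k + b' k) => x.
rewrite hf hg -big_split /=; apply: eq_bigr => i _; ring.
Qed.

Lemma trig_polyZ n f (c : R) : trig_poly n f -> trig_poly n (fun x => c * f x).
Proof.
move=> [a [b hf]]; exists (fun k => c * a k), (fun k => c * b k) => x.
rewrite hf mulr_sumr; apply: eq_bigr => i _; ring.
Qed.

Lemma trig_polyB n f g : trig_poly n f -> trig_poly n g ->
  trig_poly n (fun x => f x - g x).
Proof.
move=> hf hg; have := trig_polyD hf (trig_polyZ (-1) hg).
by under [X in trig_poly _ X -> _]eq_fun do rewrite mulN1r.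
Qed.

Lemma trig_poly0 n : trig_poly n (fun _ : R => 0).
Proof.
by exists (fun=> 0), (fun=> 0) => x; rewrite big1// => i _; rewrite !mul0r addr0.
Qed.

Lemma trig_poly_sum n m (F : nat -> R -> R) :
  (forall k, (k < m)%N -> trig_poly n (F k)) ->
  trig_poly n (fun x => \sum_(k < m) F k x).
Proof.
elim: m => [|m IH] h.
  by under [X in trig_poly _ X]eq_fun do rewrite big_ord0; exact: trig_poly0.
under [X in trig_poly _ X]eq_fun do rewrite big_ord_recr/=.
by apply: trig_polyD; [apply: IH => k km; apply/h/ltnW|exact: h].
Qed.

Lemma trig_poly_cos n k : (k < n)%N -> trig_poly n (fun x : R => cos (k%:R * x)).
Proof.
move=> kn; exists (fun j => (j == k)%:R), (fun=> 0) => x.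
rewrite (bigD1 (Ordinal kn))//= eqxx mul1r mul0r addr0 big1 ?addr0// => i.
by rewrite -val_eqE/= => /negbTE->; rewrite !mul0r addr0.
Qed.

Lemma trig_poly_sin n k : (k < n)%N -> trig_poly n (fun x : R => sin (k%:R * x)).
Proof.
move=> kn; exists (fun=> 0), (fun j => (j == k)%:R) => x.
rewrite (bigD1 (Ordinal kn))//= eqxx mul1r mul0r add0r big1 ?addr0// => i.
by rewrite -val_eqE/= => /negbTE->; rewrite !mul0r addr0.
Qed.

Lemma trig_poly_cst n (c : R) : (0 < n)%N -> trig_poly n (fun _ : R => c).
Proof.
move=> n0; have := trig_polyZ c (trig_poly_cos n0).
by under [X in trig_poly _ X -> _]eq_fun do rewrite mul0r cos0 mulr1.
Qed.

Lemma trig_poly_mono n m f : (n <= m)%N -> trig_poly n f -> trig_poly m f.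
Proof.
move=> nm [a [b hf]].
have -> : f = fun x => \sum_(k < n) (a k * cos (k%:R * x) + b k * sin (k%:R * x)).
  exact/funext.
apply: (@trig_poly_sum m n (fun k x => a k * cos (k%:R * x) + b k * sin (k%:R * x))).
move=> k kn; have km := leq_trans kn nm.
by apply: trig_polyD; apply: trig_polyZ; [exact: trig_poly_cos|exact: trig_poly_sin].
Qed.

(** Multiplication by a fixed function is linear, so that its effect on the degree
    is decided on single harmonics; there the product-to-sum formulas apply. *)
Lemma trig_poly_mul_of_harmonics n m (w : R -> R) f :
  (forall k, (k < n)%N -> trig_poly m (fun x => cos (k%:R * x) * w x)) ->
  (forall k, (k < n)%N -> trig_poly m (fun x => sin (k%:R * x) * w x)) ->
  trig_poly n f -> trig_poly m (fun x => f x * w x).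
Proof.
move=> hc hs [a [b hf]].
have -> : (fun x => f x * w x) = fun x => \sum_(k < n)
    (a k * (cos (k%:R * x) * w x) + b k * (sin (k%:R * x) * w x)).
  apply/funext => x; rewrite hf mulr_suml; apply: eq_bigr => i _; ring.
apply: (@trig_poly_sum m n (fun k x => a k * (cos (k%:R * x) * w x) +
  b k * (sin (k%:R * x) * w x))) => k kn.
by apply: trig_polyD; apply: trig_polyZ; [exact: hc|exact: hs].
Qed.

Lemma trig_poly_mul_cos n f : trig_poly n f ->
  trig_poly n.+1 (fun x => f x * cos x).
Proof.
apply: trig_poly_mul_of_harmonics => -[|k] kn.
- have -> : (fun x : R => cos (0%:R * x) * cos x) = (fun x => cos (1%:R * x)).
    by apply/funext => x; rewrite !mul0r cos0 !mul1r.
  exact: trig_poly_cos.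
- have -> : (fun x : R => cos (k.+1%:R * x) * cos x) =
     (fun x => 2^-1 * (cos (k.+2%:R * x) + cos (k%:R * x))).
    apply/funext => x.
    have -> : k.+2%:R * x = k.+1%:R * x + x by rewrite -[k.+2]addn1 natrD; ring.
    have -> : k%:R * x = k.+1%:R * x - x by rewrite -[k.+1]addn1 natrD; ring.
    by rewrite cosD cosB; field.
  apply: trig_polyZ; apply: trig_polyD; apply: trig_poly_cos => //.
  exact: leqW (ltnW kn).
- have -> : (fun x : R => sin (0%:R * x) * cos x) = (fun x => 0).
    by apply/funext => x; rewrite !mul0r sin0 !mul0r.
  exact: trig_poly0.
- have -> : (fun x : R => sin (k.+1%:R * x) * cos x) =
     (fun x => 2^-1 * (sin (k.+2%:R * x) + sin (k%:R * x))).
    apply/funext => x.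
    have -> : k.+2%:R * x = k.+1%:R * x + x by rewrite -[k.+2]addn1 natrD; ring.
    have -> : k%:R * x = k.+1%:R * x - x by rewrite -[k.+1]addn1 natrD; ring.
    by rewrite sinD sinB; field.
  apply: trig_polyZ; apply: trig_polyD; apply: trig_poly_sin => //.
  exact: leqW (ltnW kn).
Qed.

Lemma trig_poly_mul_sin n f : trig_poly n f ->
  trig_poly n.+1 (fun x => f x * sin x).
Proof.
apply: trig_poly_mul_of_harmonics => -[|k] kn.
- have -> : (fun x : R => cos (0%:R * x) * sin x) = (fun x => sin (1%:R * x)).
    by apply/funext => x; rewrite !mul0r cos0 !mul1r.
  exact: trig_poly_sin.
- have -> : (fun x : R => cos (k.+1%:R * x) * sin x) =
     (fun x => 2^-1 * (sin (k.+2%:R * x) - sin (k%:R * x))).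
    apply/funext => x.
    have -> : k.+2%:R * x = k.+1%:R * x + x by rewrite -[k.+2]addn1 natrD; ring.
    have -> : k%:R * x = k.+1%:R * x - x by rewrite -[k.+1]addn1 natrD; ring.
    by rewrite sinD sinB; field.
  apply: trig_polyZ; apply: trig_polyB; apply: trig_poly_sin => //.
  exact: leqW (ltnW kn).
- have -> : (fun x : R => sin (0%:R * x) * sin x) = (fun x => 0).
    by apply/funext => x; rewrite !mul0r sin0 !mul0r.
  exact: trig_poly0.
- have -> : (fun x : R => sin (k.+1%:R * x) * sin x) =
     (fun x => 2^-1 * (cos (k%:R * x) - cos (k.+2%:R * x))).
    apply/funext => x.
    have -> : k.+2%:R * x = k.+1%:R * x + x by rewrite -[k.+2]addn1 natrD; ring.
    have -> : k%:R * x = k.+1%:R * x - x by rewrite -[k.+1]addn1 natrD; ring.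
    by rewrite cosB cosD; field.
  apply: trig_polyZ; apply: trig_polyB; apply: trig_poly_cos => //.
  exact: leqW (ltnW kn).
Qed.

Lemma trig_poly_bounded n f : trig_poly n f -> exists2 C : R, 0 <= C & forall x, `|f x| <= C.
Proof.
move=> [a [b hf]]; exists (\sum_(k < n) (`|a k| + `|b k|)).
  by apply: sumr_ge0 => i _; rewrite addr_ge0.
move=> x; rewrite hf; apply: le_trans (ler_norm_sum _ _ _) _.
apply: ler_sum => i _; apply: le_trans (ler_normD _ _) _; rewrite !normrM.
by apply: lerD; rewrite ler_piMr ?cos_max ?sin_max.
Qed.

Lemma trig_poly_derive n f : trig_poly n f ->
  (forall x : R, is_derive x 1 f (derive1 f x)) /\ trig_poly n (derive1 f).
Proof.
move=> [a [b hf]].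
have fE : f = fun x => \sum_(k < n) (a k * cos (k%:R * x) + b k * sin (k%:R * x)).
  exact/funext.
pose g (x : R) := \sum_(k < n) (k%:R * b k * cos (k%:R * x) + - (k%:R * a k) * sin (k%:R * x)).
have df (x : R) : is_derive x 1 f (g x).
  rewrite fE /g.
  have -> : (fun x => \sum_(k < n) (a k * cos (k%:R * x) + b k * sin (k%:R * x))) =
    (\sum_(k < n) (fun x => a k * cos (k%:R * x) + b k * sin (k%:R * x))).
    by apply/funext => y; rewrite fct_sumE.
  apply: is_derive_sum => i.
  have hc := is_derive_comp_scale (is_derive_cos (i%:R * x)).
  have hs := is_derive_comp_scale (is_derive_sin (i%:R * x)).
  have h := is_deriveD (is_deriveZ (a i) hc) (is_deriveZ (b i) hs).
  by apply: is_derive_eq; rewrite /GRing.scale /=; ring.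
have gE : derive1 f = g by apply/funext => x; rewrite derive1E; apply: derive_val.
by split=> [x|]; rewrite gE//; exists (fun k => k%:R * b k), (fun k => - (k%:R * a k)).
Qed.

Lemma trig_poly_derive1n n f j : trig_poly n f -> trig_poly n (derive1n j f).
Proof.
move=> hf; elim: j => [//|j IH]; rewrite derive1nS.
by case: (trig_poly_derive IH).
Qed.

Lemma trig_poly_chain n f k : trig_poly n f ->
  derivative_chain k (fun j => derive1n j f).
Proof.
move=> hf j x _; rewrite derive1nS.
by case: (trig_poly_derive (trig_poly_derive1n j hf)).
Qed.

Lemma trig_poly_continuous n f : trig_poly n f -> continuous f.
Proof.
by move=> /trig_poly_derive[h _] x; exact: is_derive_continuous (h x).
Qed.

Lemma trig_poly_derive1nB n f g j : trig_poly n f -> trig_poly n g ->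
  derive1n j (f \- g) = derive1n j f \- derive1n j g.
Proof.
move=> hf hg.
apply: (@derivative_chain_derive1n R j (fun i => derive1n i f \- derive1n i g)) => // i x ij.
exact: is_deriveB (trig_poly_chain hf x ij) (trig_poly_chain hg x ij).
Qed.

End trigonometric_polynomials.
(** * Bernstein's inequality *)

Section bernstein.
Context {R : realType}.
Implicit Types (f g T : R -> R).

Definition circle_node (M j : nat) : R := j%:R * (pi *+ 2 / M%:R).

Lemma cosD_int2pi (x : R) (k : nat) : cos (x + pi *+ 2 * k%:R) = cos x.
Proof. by rewrite mulr_natr (periodicn (@cosD2pi R)). Qed.

(** Multiplied by [2 sin (k pi / M)], each term becomes a difference of two
    consecutive cosines, and the telescoping sum closes up after a whole number of
    turns. The factor is nonzero since [0 < k < M]. *)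
Lemma sum_sin_nodes (M k : nat) (x : R) : (0 < k < M)%N ->
  \sum_(j < M) sin (k%:R * circle_node M j + x) = 0.
Proof.
move=> /andP[k0 kM]; have M0 : (0 < M)%N by apply: leq_trans kM.
have M0R : M%:R != 0 :> R by rewrite pnatr_eq0 -lt0n.
pose th : R := pi * (k%:R / M%:R).
have sth : 0 < sin th.
  apply: sin_gt0_pi; rewrite mulr_gt0 ?pi_gt0 ?divr_gt0 ?ltr0n//=.
  by rewrite gtr_pMr ?pi_gt0// ltr_pdivrMr ?ltr0n// mul1r ltr_nat.
have nz : 2 * sin th != 0 by rewrite mulf_neq0 ?lt0r_neq0.
apply: (mulfI nz); rewrite mulr0 mulr_sumr.
pose C (j : nat) := cos (k%:R * circle_node M j + x - th).
rewrite (eq_bigr (fun j : 'I_M => C j - C j.+1)); last first.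
  move=> j _; rewrite /C.
  have -> : k%:R * circle_node M j.+1 + x - th = k%:R * circle_node M j + x + th.
    by rewrite /circle_node /th -[j.+1]addn1 natrD mulr2n; field.
  by move: (_ + x) th {sth nz C} => y t; rewrite cosB cosD; ring.
rewrite -(big_mkord xpredT (fun j => C j - C j.+1)).
under eq_bigr do rewrite -opprB.
rewrite sumrN telescope_sumr// /C.
have -> : k%:R * circle_node M M + x - th = (k%:R * circle_node M 0 + x - th) + pi *+ 2 * k%:R.
  by rewrite /circle_node mulr2n; field.
by rewrite cosD_int2pi subrr oppr0.
Qed.

Lemma sum_sin_nodes_int (M : nat) (k : int) (x : R) : (0 < `|k| < M)%N ->
  \sum_(j < M) sin (k%:~R * circle_node M j + x) = 0.
Proof.
case: k => k; first by rewrite -pmulrn; exact: sum_sin_nodes.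
rewrite NegzE abszN => kM; rewrite -[RHS]oppr0 -[X in _ = - X](sum_sin_nodes (- x) kM) -sumrN.
by apply: eq_bigr => j _; rewrite -sinN; congr sin; rewrite mulrNz -pmulrn mulNr opprD opprK.
Qed.

(** The Fejer kernel of degree [n - 1] without its normalisation by [1 / n], namely
    the squared modulus of the sum of [exp (i k t)] over [k < n]. This form makes its
    nonnegativity evident. *)
Definition fejer_kernel n (t : R) :=
  (\sum_(k < n) cos (k%:R * t)) ^+ 2 + (\sum_(k < n) sin (k%:R * t)) ^+ 2.

Lemma fejer_kernel_ge0 n t : 0 <= fejer_kernel n t.
Proof. by rewrite addr_ge0 ?sqr_ge0. Qed.

Lemma fejer_kernelE n t :
  fejer_kernel n t = \sum_(k < n) \sum_(l < n) cos ((k%:Z - l%:Z)%:~R * t).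
Proof.
rewrite /fejer_kernel !expr2 !big_distrlr /= -big_split /=.
apply: eq_bigr => k _; rewrite -big_split /=; apply: eq_bigr => l _.
by rewrite intrB -!pmulrn mulrBl cosB.
Qed.

(** After expansion into cosines of [(k - l) t], only the [n] diagonal terms survive
    the average over the nodes. *)
Lemma fejer_kernel_mean n M : (n <= M)%N ->
  \sum_(j < M) fejer_kernel n (circle_node M j) = (n * M)%:R.
Proof.
move=> nM; under eq_bigr do rewrite fejer_kernelE.
rewrite exchange_big /=.
rewrite (eq_bigr (fun=> M%:R)); last first.
  move=> k _; rewrite exchange_big /= (bigD1 k)//= [X in _ + X]big1 ?addr0.
    rewrite (eq_bigr (fun=> 1)); first by rewrite sumr_const card_ord.
    by move=> j _; rewrite subrr mul0r cos0.
  move=> l lk; rewrite -[RHS](@sum_sin_nodes_int M (k%:Z - l%:Z) (pi / 2)).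
    by apply: eq_bigr => j _; rewrite sinDpihalf.
  apply/andP; split; first by rewrite absz_gt0 subr_eq0 eqz_nat eq_sym.
  have := ltn_ord k; have := ltn_ord l; lia.
by rewrite sumr_const card_ord natrM mulr_natl.
Qed.

(** The frequencies [n + k - l] come from the product-to-sum formula; the companion
    terms cancel under the exchange of [k] and [l]. *)
Lemma fejer_sin_kernelE n t : 2 * sin (n%:R * t) * fejer_kernel n t =
  2 * \sum_(k < n) \sum_(l < n) sin ((n%:Z + k%:Z - l%:Z)%:~R * t).
Proof.
rewrite fejer_kernelE -mulrA; congr (_ * _).
(* The sum is antisymmetric in [k] and [l]. *)
have E : \sum_(k < n) \sum_(l < n) cos (n%:R * t) * sin ((k%:Z - l%:Z)%:~R * t) = 0.
  set S := LHS; suff : S = - S by move=> h; lra.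
  rewrite {1}/S exchange_big /= -sumrN; apply: eq_bigr => k _.
  rewrite -sumrN; apply: eq_bigr => l _.
  by rewrite -mulrN -sinN -mulNr -intrN opprB.
rewrite -[LHS]addr0 -[X in _ + X = _]E mulr_sumr -big_split /=; apply: eq_bigr => k _.
rewrite mulr_sumr -big_split /=; apply: eq_bigr => l _.
by rewrite -sinD -mulrDl -addrA [in RHS]intrD -pmulrn.
Qed.

(** The heart of Bernstein's inequality: averaging against the kernel
    [2 sin (n t) F(t)], with [F] the Fejer kernel, differentiates every harmonic of
    frequency [m < n]. Exactly [m] pairs [(k, l)] satisfy [n + k - l = m], and all
    other terms average to zero over [3 n] nodes, because the frequencies
    [n + k - l + m] and [n + k - l - m] stay below [3 n] in modulus. *)
Lemma fejer_sin_reproduces n m (y : R) : (m < n)%N ->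
  \sum_(j < 3 * n) cos (m%:R * circle_node (3 * n) j + y) *
    (2 * sin (n%:R * circle_node (3 * n) j) * fejer_kernel n (circle_node (3 * n) j)) =
  - (3 * n)%:R * (m%:R * sin y).
Proof.
move=> mn; set M := (3 * n)%N.
transitivity (\sum_(k < n) \sum_(l < n) \sum_(j < M)
   (sin ((n%:Z + k%:Z - l%:Z + m%:Z)%:~R * circle_node M j + y) +
    sin ((n%:Z + k%:Z - l%:Z - m%:Z)%:~R * circle_node M j - y))).
  under eq_bigr => j _.
    rewrite fejer_sin_kernelE mulrCA !mulr_sumr.
    under eq_bigr => k _.
      rewrite !mulr_sumr.
      under eq_bigr => l _.
        have -> : 2 * (cos (m%:R * circle_node M j + y) * sin ((n%:Z + k%:Z - l%:Z)%:~R * circle_node M j)) =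
          (sin ((n%:Z + k%:Z - l%:Z + m%:Z)%:~R * circle_node M j + y) +
          sin ((n%:Z + k%:Z - l%:Z - m%:Z)%:~R * circle_node M j - y)).
          set A := (n%:Z + k%:Z - l%:Z).
          have -> : (A + m%:Z)%:~R * circle_node M j + y = A%:~R * circle_node M j + (m%:R * circle_node M j + y).
            by rewrite intrD -pmulrn; ring.
          have -> : (A - m%:Z)%:~R * circle_node M j - y = A%:~R * circle_node M j - (m%:R * circle_node M j + y).
            by rewrite intrB -pmulrn; ring.
          by rewrite sinB sinD; ring.
        over.
      over.
    over.
  rewrite exchange_big /=; apply: eq_bigr => k _.
  by rewrite exchange_big.
transitivity (\sum_(k < n) \sum_(l < n) (- (M%:R * sin y) *+ (n + k == m + l)%N)).
  apply: eq_bigr => k _; apply: eq_bigr => l _.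
  have kn := ltn_ord k; have ln := ltn_ord l.
  rewrite big_split /= sum_sin_nodes_int ?add0r; last first.
    by rewrite /M; apply/andP; split; lia.
  case: eqP => [e|ne].
    rewrite (eq_bigr (fun=> - sin y)); first by rewrite sumr_const card_ord mulr1n mulr_natl mulNrn.
    move=> j _; have -> : n%:Z + k%:Z - l%:Z - m%:Z = 0 by lia.
    by rewrite mul0r sub0r sinN.
  by rewrite sum_sin_nodes_int// /M; apply/andP; split; lia.
transitivity (\sum_(k < n) (- (M%:R * sin y) *+ (k < m)%N)).
  apply: eq_bigr => k _; case: ltnP => km.
    have h : (n + k - m < n)%N by have := ltn_ord k; lia.
    rewrite (bigD1 (Ordinal h))//= big1 ?addr0.
      by congr (_ *+ _); have -> : (n + k == m + (n + k - m))%N by apply/eqP; lia.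
    move=> l; rewrite -val_eqE /= => lne.
    by case: eqP => // e; exfalso; move/eqP: lne; apply; lia.
  rewrite big1// => l _; case: eqP => // e; have := ltn_ord l; lia.
rewrite -(big_mkord xpredT (fun k => - (M%:R * sin y) *+ (k < m)%N)).
rewrite (big_cat_nat _ (ltnW mn))//= [X in _ + X]big1_seq ?addr0; last first.
  by move=> i; rewrite mem_index_iota => /andP[_ /andP[mi _]]; rewrite ltnNge mi.
rewrite (eq_big_seq (fun=> - (M%:R * sin y))); last first.
  by move=> i; rewrite mem_index_iota => /andP[_ im]; rewrite im.
by rewrite sumr_const_nat subn0 -mulr_natl; ring.
Qed.

(** A sine is a cosine shifted by a quarter of a turn, so both parts of [T] are
    covered by the reproducing formula for [cos (m t + y)]. *)
Lemma trig_poly_derive_mean n T x : trig_poly n T ->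
  (3 * n)%:R * derive1 T x = \sum_(j < 3 * n) T (x + circle_node (3 * n) j) *
    (2 * sin (n%:R * circle_node (3 * n) j) * fejer_kernel n (circle_node (3 * n) j)).
Proof.
move=> [a [b hT]].
pose w j : R := 2 * sin (n%:R * circle_node (3 * n) j) * fejer_kernel n (circle_node (3 * n) j).
have Tc : T = fun x => \sum_(k < n) (a k * cos (k%:R * x) + b k * sin (k%:R * x)).
  exact/funext.
have dT : is_derive x 1 T
    (\sum_(k < n) (a k * (k%:R * - sin (k%:R * x)) + b k * (k%:R * cos (k%:R * x)))).
  have -> : T = (\sum_(k < n) (fun x => a k * cos (k%:R * x) + b k * sin (k%:R * x))).
    by rewrite Tc; apply/funext => y; rewrite fct_sumE.
  apply: is_derive_sum => i.
  have hc := is_derive_comp_scale (is_derive_cos (i%:R * x)).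
  have hs := is_derive_comp_scale (is_derive_sin (i%:R * x)).
  by have h := is_deriveD (is_deriveZ (a i) hc) (is_deriveZ (b i) hs).
have -> : derive1 T x = \sum_(k < n) (a k * (k%:R * - sin (k%:R * x)) + b k * (k%:R * cos (k%:R * x))).
  by rewrite derive1E; case: dT.
under [RHS]eq_bigr do rewrite hT mulr_suml.
rewrite exchange_big /= mulr_sumr; apply: eq_bigr => k _.
have kn := ltn_ord k.
have e1 := fejer_sin_reproduces (k%:R * x) kn.
have e2 := fejer_sin_reproduces (k%:R * x - pi / 2) kn.
rewrite sinBpihalf in e2.
transitivity (a k * (- (3 * n)%:R * (k%:R * sin (k%:R * x))) +
  b k * (- (3 * n)%:R * (k%:R * - cos (k%:R * x)))); first by ring.
rewrite -e1 -e2 !mulr_sumr -big_split /=; apply: eq_bigr => j _.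
set t := circle_node _ _.
have -> : k%:R * t + (k%:R * x - pi / 2) = k%:R * (x + t) - pi / 2 by ring.
have -> : k%:R * t + k%:R * x = k%:R * (x + t) by ring.
by rewrite cosBpihalf; ring.
Qed.

(** The kernel of [trig_poly_derive_mean] is dominated by twice the Fejer kernel,
    which is nonnegative with mean [n]. The constant [2] instead of the optimal [1] is
    harmless below, where only the linear growth in [n] matters. *)
Lemma bernstein n T (B : R) : trig_poly n T -> (forall x, `|T x| <= B) ->
  forall x, `|derive1 T x| <= 2 * n%:R * B.
Proof.
move=> hT hB x.
have B0 : 0 <= B by apply: le_trans (hB 0).
case: n hT => [|n] hT.
  have -> : T = cst 0.
    by case: hT => a [b h]; apply/funext => y; rewrite h big_ord0.
  by rewrite derive1_cst normr0 mulr0 mul0r.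
have M0 : 0 < (3 * n.+1)%:R :> R by rewrite ltr0n.
rewrite -(ler_pM2l M0) -[X in X * `|_|]gtr0_norm// -normrM (trig_poly_derive_mean x hT).
apply: le_trans (ler_norm_sum _ _ _) _.
have -> : (3 * n.+1)%:R * (2 * n.+1%:R * B) = 2 * B * (n.+1 * (3 * n.+1))%:R :> R.
  by rewrite natrM; ring.
rewrite -(@fejer_kernel_mean n.+1 (3 * n.+1)) ?leq_pmull// mulr_sumr.
apply: ler_sum => j _.
rewrite !normrM (ger0_norm (fejer_kernel_ge0 _ _)) (ger0_norm (ler0n R 2)).
rewrite [2 * B]mulrC mulrA ler_wpM2r ?fejer_kernel_ge0//.
rewrite ler_pM// ?mulr_ge0//.
by rewrite ler_piMr// sin_max.
Qed.

Lemma bernstein_derive1n n T (B : R) j : trig_poly n T -> (forall x, `|T x| <= B) ->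
  forall x, `|derive1n j T x| <= (2 * n%:R) ^+ j * B.
Proof.
move=> hT hB; elim: j => [|j IH] x; first by rewrite expr0 mul1r.
by rewrite derive1nS exprS -mulrA; apply: bernstein => //; exact: trig_poly_derive1n.
Qed.

End bernstein.
(** * The uniform norm and the second modulus of smoothness *)

Section norms_and_moduli.
Context {R : realType}.
Implicit Types (f g T : R -> R).

Lemma le_max_norm f C x : (forall y, `|f y| <= C) -> `|f x| <= max_norm f.
Proof.
move=> h; apply: ub_le_sup; last by exists x.
by exists C => _ [y _ <-].
Qed.

Lemma max_norm_le f C : (forall x, `|f x| <= C) -> max_norm f <= C.
Proof.
by move=> h; apply: ge_sup => [|_ [y _ <-]//]; exists `|f 0|; exists 0.
Qed.

Lemma max_norm_ge0 f : 0 <= max_norm f.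
Proof.
rewrite /max_norm; set A := [set _ | _ in _].
have [hs|/sup_out->//] := pselect (has_sup A).
apply: le_trans (normr_ge0 (f 0)) _; apply: ub_le_sup; first by case: hs.
by exists 0.
Qed.

Lemma omega_ge0 k g t : 0 <= omega k g t.
Proof.
rewrite /omega; set A := [set _ | _ in _].
have [hs|/sup_out->//] := pselect (has_sup A).
case: (hs) => -[a Aa] hu; have [h ht ha] := Aa.
apply: (@le_trans _ _ a); first by rewrite -ha max_norm_ge0.
exact: ub_le_sup.
Qed.

Lemma fwd_diff2E g (h x : R) :
  fwd_diff 2 h g x = (g (x + h + h) - g (x + h)) - (g (x + h) - g x).
Proof.
rewrite /fwd_diff !big_ord_recr big_ord0 /= /bump /=.
have -> : x + 2 * h = x + h + h by ring.
by rewrite binn bin0 bin1 expr0 expr1 sqrrN expr1n !mul1r mul0r addr0; ring.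
Qed.

Lemma derive_lipschitz g g1 (M : R) : (forall x : R, is_derive x 1 g (g1 x)) ->
  (forall x, `|g1 x| <= M) -> forall x y, `|g y - g x| <= M * `|y - x|.
Proof.
move=> dg bg; have cg : continuous g by move=> x; exact: is_derive_continuous (dg x).
have aux x y : x <= y -> `|g y - g x| <= M * `|y - x|.
  move=> xy; have [c _ ->] := @MVT_segment R g g1 x y xy (fun x _ => dg x)
    (continuous_subspaceT cg).
  by rewrite normrM ler_wpM2r.
move=> x y; have [|/ltW] := leP x y; first exact: aux.
by rewrite distrC (distrC y); exact: aux.
Qed.

Lemma is_derive_comp_shift f (h x df : R) :
  is_derive (x + h) 1 f df -> is_derive x 1 (fun y => f (y + h)) df.
Proof.
move=> hf; have h2 : is_derive x 1 (fun y => y + h) 1.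
  have := is_deriveD (is_derive_id x 1) (is_derive_cst h x 1).
  by rewrite addr0.
by have := @is_derive1_comp R f (fun y => y + h) x df 1 hf h2; rewrite mulr1.
Qed.

(** A second difference of a twice differentiable function is at most
    [M h ^ 2] by two applications of the mean value theorem, and a perturbation of size
    [eta] changes it by at most [(1 + 2 + 1) eta]. *)
Lemma omega2_le f g g1 g2 (M eta t : R) : 0 < t ->
  (forall x : R, is_derive x 1 g (g1 x)) -> (forall x : R, is_derive x 1 g1 (g2 x)) ->
  (forall x, `|g2 x| <= M) -> (forall x, `|f x - g x| <= eta) ->
  omega 2 f t <= M * t ^+ 2 + 4 * eta.
Proof.
move=> t0 dg dg1 bg2 fg.
have M0 : 0 <= M by apply: le_trans (bg2 0).
apply: ge_sup; first by exists (max_norm (fwd_diff 2 t f)), t => //=; rewrite t0 lexx.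
move=> _ [h /= /andP[h0 ht] <-]; apply: max_norm_le => x.
have dd (y : R) : is_derive y 1 (fun z => g (z + h) - g z) (g1 (y + h) - g1 y).
  by apply: is_deriveB; exact: is_derive_comp_shift.
have bd y : `|g1 (y + h) - g1 y| <= M * h.
  have := derive_lipschitz dg1 bg2 y (y + h).
  by have -> : y + h - y = h by [ring]; rewrite (gtr0_norm h0).
have := derive_lipschitz dd bd x (x + h).
have -> : x + h - x = h by ring.
rewrite (gtr0_norm h0) /= => D2.
have Mt : M * h * h <= M * t ^+ 2.
  by rewrite -mulrA -expr2 ler_wpM2l// ler_pXn2r// nnegrE ltW.
rewrite fwd_diff2E.
have := fg x; have := fg (x + h); have := fg (x + h + h).
move: D2; rewrite !ler_norml => /andP[? ?] /andP[? ?] /andP[? ?] /andP[? ?].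
by apply/andP; split; lra.
Qed.

End norms_and_moduli.

(** * Comonotonicity and zeros of derivatives *)

Section zeros_of_derivatives.
Context {R : realType}.

(** Each application of Rolle's theorem loses one zero, so that [r + 1] zeros of
    [D 0] leave one for [D r]. *)
Lemma derivative_chain_rolle r (D : nat -> R -> R) (z : nat -> R) :
  derivative_chain r D -> (forall j, (j < r)%N -> z j < z j.+1) ->
  (forall j, (j <= r)%N -> D 0%N (z j) = 0) ->
  exists2 xi, z 0%N <= xi <= z r & D r xi = 0.
Proof.
elim: r D z => [|r IH] D z chD zS Dz; first by exists (z 0%N); rewrite ?lexx ?Dz.
have ex_zero j : exists w : R, (j <= r)%N -> z j < w < z j.+1 /\ D 1%N w = 0.
  have [jr|] := leqP j r; last by exists 0.
  have cD : continuous (D 0%N) by move=> x; exact: is_derive_continuous (chD 0%N x _).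
  have [c cz dc] := @Rolle R (D 0%N) (z j) (z j.+1) (zS j jr)
    (fun x _ => @derivative_chain_derivable R _ D 0 x chD (ltn0Sn r))
    (continuous_subspaceT cD) (etrans (Dz j (leqW jr)) (esym (Dz j.+1 jr))).
  exists c => _; split; first by rewrite !(itvP cz).
  by case: dc => _ <-; case: (chD 0%N c (ltn0Sn r)).
have [w hw] := choice ex_zero.
have [xi /andP[l u] xi0] : exists2 xi, w 0%N <= xi <= w r & D r.+1 xi = 0.
  apply: (IH (fun j => D j.+1) w).
  - by move=> j x jr; exact: chD.
  - move=> j jr; have [/andP[_ +] _] := hw j (ltnW jr).
    by have [/andP[+ _] _] := hw j.+1 jr; move=> b a; exact: lt_trans a b.
  - by move=> j jr; have [_] := hw j jr.
exists xi => //; have [/andP[h0 _] _] := hw 0%N isT.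
have [/andP[_ h1] _] := hw r (leqnn r).
by rewrite (le_trans (ltW h0) l) (le_trans u (ltW h1)).
Qed.

(** The direction of monotonicity is reversed at every point of the collection,
    which is therefore a local extremum. *)
Lemma Delta1_derive_eq0 s (Y : int -> R) (T : R -> R) (i : int) :
  collection s Y -> Delta1 Y T -> (forall x : R, derivable T x 1) ->
  derive1 T (Y i) = 0.
Proof.
move=> cY [_ mT] dT.
have l1 : Y (i - 1) < Y i by have [] := cY (i - 1); rewrite subrK.
have l2 : Y i < Y (i + 1) by have [] := cY i.
have L x : x \in `](Y (i - 1)), (Y (i + 1))[ -> x <= Y i ->
    (-1) ^ (i - 1) * T x <= (-1) ^ (i - 1) * T (Y i).
  rewrite in_itv /= => /andP[x1 _] x2.
  by apply: (mT i) => //; rewrite in_itv /= ?lexx ?(ltW x1) ?(ltW l1) ?x2.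
have U x : x \in `](Y (i - 1)), (Y (i + 1))[ -> Y i <= x ->
    (-1) ^ i * T (Y i) <= (-1) ^ i * T x.
  rewrite in_itv /= => /andP[_ x1] x2.
  have := mT (i + 1); rewrite addrK; apply => //;
  by rewrite in_itv /= ?lexx ?(ltW x1) ?(ltW l2) ?x2.
have sg : (-1 : R) ^ (i - 1) = - (-1) ^ i.
  by rewrite expfzDr ?oppr_eq0 ?oner_eq0// exprN1 invrN1 mulrN1.
have Yi : Y i \in `](Y (i - 1)), (Y (i + 1))[ by rewrite in_itv /= l1 l2.
have l12 := ltW (lt_trans l1 l2).
rewrite derive1E; suff : is_derive (Y i) 1 T 0 by case.
have : (-1 : R) ^ i = 1 \/ (-1 : R) ^ i = -1.
  by rewrite expN1r -signr_odd; case: (odd _); [right|left]; rewrite ?expr1 ?expr0.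
case=> e; rewrite sg e ?opprK in L; rewrite e in U.
- apply: (derive1_at_min l12) => // x xI; have [xY|/ltW xY] := leP x (Y i).
    by have := L x xI xY; rewrite !mulN1r lerN2.
  by have := U x xI xY; rewrite !mul1r.
- apply: (derive1_at_max l12) => // x xI; have [xY|/ltW xY] := leP x (Y i).
    by have := L x xI xY; rewrite !mul1r.
  by have := U x xI xY; rewrite !mulN1r lerN2.
Qed.

End zeros_of_derivatives.
(** * The soft threshold and its powers *)

Section soft_threshold.
Context {R : realType}.
Implicit Types (e t x : R).

(** This is [sign t * max (|t| - e) 0]: zero on [[- e, e]], at distance at most [e]
    from the identity, and equal to it for [e = 0]. *)
Definition soft_threshold e t : R := Num.max (t - e) 0 - Num.max (- t - e) 0.

Lemma soft_threshold_gt e t : 0 <= e -> e <= t -> soft_threshold e t = t - e.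
Proof.
by move=> e0 et; rewrite /soft_threshold max_l ?max_r ?subr0//; lra.
Qed.

Lemma soft_threshold_lt e t : 0 <= e -> t <= - e -> soft_threshold e t = t + e.
Proof.
by move=> e0 et; rewrite /soft_threshold max_r ?max_l; lra.
Qed.

Lemma soft_threshold_mid e t : `|t| <= e -> soft_threshold e t = 0.
Proof.
by rewrite ler_norml => /andP[? ?]; rewrite /soft_threshold !max_r ?subr0//; lra.
Qed.

Variant soft_threshold_spec e t : R -> Type :=
| SoftThresholdGt of e < t : soft_threshold_spec e t (t - e)
| SoftThresholdLt of t < - e : soft_threshold_spec e t (t + e)
| SoftThresholdMid of - e <= t & t <= e : soft_threshold_spec e t 0.

Lemma soft_thresholdP e t : 0 <= e -> soft_threshold_spec e t (soft_threshold e t).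
Proof.
move=> e0; have [et|te] := ltP e t.
  by rewrite soft_threshold_gt ?(ltW et)//; constructor.
have [et|et] := ltP t (- e).
  by rewrite soft_threshold_lt ?(ltW et)//; constructor.
by rewrite soft_threshold_mid ?ler_norml ?et//; constructor.
Qed.

Lemma soft_threshold0 t : soft_threshold 0 t = t.
Proof. by case: soft_thresholdP => // *; lra. Qed.

Lemma soft_threshold_lipschitz e x t : 0 <= e ->
  `|soft_threshold e x - soft_threshold e t| <= `|x - t|.
Proof.
move=> e0; case: soft_thresholdP => // ?; case: soft_thresholdP => // ?;
by have := ler_norm (x - t); have := lerNnormlW (lexx `|x - t|); rewrite ?ler_norml => *;
apply/andP; split; lra.
Qed.

Lemma le_soft_threshold e : 0 <= e -> {homo soft_threshold e : x t / x <= t}.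
Proof.
by move=> e0 x t xt; case: soft_thresholdP => // ?; case: soft_thresholdP => // *; lra.
Qed.

Lemma soft_threshold_ge0 e t : 0 <= e -> 0 <= t -> 0 <= soft_threshold e t.
Proof. by move=> e0 t0; case: soft_thresholdP => // *; lra. Qed.

Lemma soft_threshold_dist e t : 0 <= e -> `|soft_threshold e t - t| <= e.
Proof. by move=> e0; rewrite ler_norml; case: soft_thresholdP => // *; lra. Qed.

Lemma soft_threshold_norm_le e t : 0 <= e -> `|soft_threshold e t| <= `|t|.
Proof.
move=> e0; have := soft_threshold_lipschitz t 0 e0.
by rewrite (@soft_threshold_mid e 0) ?normr0// !subr0.
Qed.

Lemma continuous_soft_threshold e : 0 <= e -> continuous (soft_threshold e).
Proof.
move=> e0 x; apply/cvgrPdist_lt => eps eps0; near=> y.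
apply: le_lt_trans (soft_threshold_lipschitz _ _ e0) _.
near: y; exact: cvgr_dist_lt.
Unshelve. all: by end_near. Qed.

Lemma soft_threshold_pow_dist e t m : 0 <= e -> `|t| <= 1 ->
  `|soft_threshold e t ^+ m - t ^+ m| <= m%:R * e.
Proof.
move=> e0 t1; have s1 := le_trans (soft_threshold_norm_le t e0) t1.
elim: m => [|m IH]; first by rewrite !expr0 subrr normr0 mul0r.
set s := soft_threshold e t in s1 IH *.
have -> : s ^+ m.+1 - t ^+ m.+1 = s * (s ^+ m - t ^+ m) + (s - t) * t ^+ m.
  by rewrite !exprS; ring.
apply: le_trans (ler_normD _ _) _.
have -> : m.+1%:R * e = m%:R * e + e by rewrite -natr1; ring.
rewrite !normrM; apply: lerD.
  by apply: le_trans IH; rewrite ler_piMl.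
apply: le_trans (soft_threshold_dist t e0); rewrite ler_piMr// normrX.
exact: exprn_ile1.
Qed.

Lemma is_derive_of_quadratic (f : R -> R) x : f x = 0 ->
  (forall y, `|y - x| <= 1 -> `|f y| <= `|y - x| ^+ 2) -> is_derive x 1 f 0.
Proof.
move=> fx0 hf.
have h : (fun h : R => h^-1 *: (f (h *: 1 + x) - f x)) @ 0^' --> (0 : R).
  apply/cvgr0Pnorm_lt => eps eps0; near=> h.
  have h0 : h != 0 by near: h; exact: nbhs_dnbhs_neq.
  rewrite fx0 subr0 normrZ /GRing.scale /= mulr1.
  have hx : h + x - x = h by ring.
  have := hf (h + x); rewrite hx => hb.
  have h1 : `|h| < 1 by near: h; exact: dnbhs0_lt.
  have he : `|h| < eps by near: h; exact: dnbhs0_lt.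
  apply: le_lt_trans he; rewrite normfV ler_pdivrMl ?normr_gt0// -expr2.
  exact: hb (ltW h1).
by apply: DeriveDef; [exact: cvgP h|exact: cvg_lim h].
Unshelve. all: by end_near. Qed.

(** From the second power on, the corners at [- e] and [e] are smoothed out, as
    the function is quadratically small there. *)
Lemma is_derive_soft_threshold_pow e t m : 0 <= e ->
  is_derive t 1 (fun u => soft_threshold e u ^+ m.+2)
    (m.+2%:R * soft_threshold e t ^+ m.+1).
Proof.
move=> e0.
have shifted (c : R) : is_derive t 1 (fun u => (u + c) ^+ m.+2) (m.+2%:R * (t + c) ^+ m.+1).
  have h := is_deriveD (is_derive_id t 1) (is_derive_cst c t 1).
  have h2 := @is_deriveX R _ (id + cst c) m.+2 t 1 _ h.
  have -> : (fun u => (u + c) ^+ m.+2) = (id + cst c) ^+ m.+2.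
    by apply/funext => u; rewrite exprfctE.
  by apply: is_derive_eq; rewrite addr0 /GRing.scale /= mulr1.
have [et|te] := ltP e t.
  rewrite soft_threshold_gt ?(ltW et)//; apply: near_eq_is_derive (shifted (- e)).
  by near=> u; rewrite soft_threshold_gt// ltW//; near: u; exact: lt_nbhsr.
have [et|et] := ltP t (- e).
  rewrite soft_threshold_lt ?(ltW et)//; apply: near_eq_is_derive (shifted e).
  by near=> u; rewrite soft_threshold_lt// ltW//; near: u; exact: lt_nbhsl.
have st0 : soft_threshold e t = 0 by rewrite soft_threshold_mid// ler_norml et te.
rewrite st0 expr0n /= mulr0; apply: is_derive_of_quadratic; first by rewrite st0 expr0n.
move=> y y1; rewrite normrX; have := soft_threshold_lipschitz y t e0; rewrite st0 subr0 => h.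
apply: (@le_trans _ _ (`|y - t| ^+ m.+2)); first by rewrite ler_pXn2r ?nnegrE.
by rewrite ler_wiXn2l.
Unshelve. all: by end_near. Qed.

(** For [j < m] this is the [j]th derivative of the [m]th power of the soft threshold;
    for [e = 0] it is the [j]th derivative of the monomial of degree [m]. *)
Definition soft_power e m j t : R := (m ^_ j)%:R * soft_threshold e t ^+ (m - j).

Lemma soft_power_chain e r : 0 <= e -> derivative_chain r (soft_power e r.+1).
Proof.
move=> e0 j x jr.
have [m mE] : exists m, (r.+1 - j = m.+2)%N.
  by exists (r.+1 - j - 2)%N; move: jr; lia.
have m1 : (r.+1 - j.+1 = m.+1)%N by move: mE jr; lia.
rewrite /soft_power m1 ffactnSr mE.
have h := is_deriveZ (r.+1 ^_ j)%:R (is_derive_soft_threshold_pow x m e0).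
by apply: is_derive_eq; rewrite natrM /GRing.scale /= mulrA.
Qed.

Lemma continuous_soft_power e m j : 0 <= e -> continuous (soft_power e m j).
Proof.
move=> e0 x; apply: cvgM; first exact: cvg_cst.
apply: (@continuous_comp _ _ _ (soft_threshold e) (fun y => y ^+ (m - j))).
  exact: continuous_soft_threshold.
exact: exprn_continuous.
Qed.

Lemma soft_power_dist e m j t : 0 <= e -> `|t| <= 1 ->
  `|soft_power e m j t - soft_power 0 m j t| <= (m ^_ j)%:R * m%:R * e.
Proof.
move=> e0 t1; rewrite /soft_power -mulrBr normrM ger0_norm// -mulrA ler_wpM2l//.
rewrite soft_threshold0; apply: le_trans (soft_threshold_pow_dist _ e0 t1) _.
by rewrite ler_wpM2r// ler_nat leq_subr.
Qed.

End soft_threshold.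

(** * Derivatives of compositions with the sine *)

Section composition_with_sine.
Context {R : realType}.
Implicit Types (f q : R -> R) (d D : nat -> R -> R).

(** The derivative of [d0 (sin x) q(x)] is [d1 (sin x) (q(x) cos x) + d0 (sin x) q'(x)],
    a sum of two expressions of the same shape with one derivative less to take: the
    induction is on [k], for all weights [q] at once. The constant is uniform in [d],
    so that if [d] is small up to order [k], then so is the composition. *)
Lemma comp_sin_chain k n q : trig_poly n q -> exists2 C : R, 0 <= C &
  forall d, derivative_chain k d -> continuous (d k) ->
  exists D, [/\ D 0%N = (fun x => d 0%N (sin x) * q x),
    derivative_chain k D, continuous (D k) &
    forall eta, (forall j t, (j <= k)%N -> `|t| <= 1 -> `|d j t| <= eta) ->
      forall j x, (j <= k)%N -> `|D j x| <= C * eta].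
Proof.
elim: k n q => [|k IH] n q hq.
  have [C C0 qC] := trig_poly_bounded hq; exists C => // d _ cd.
  exists (fun _ x => d 0%N (sin x) * q x); split=> //.
    move=> x; apply: cvgM; last exact: (trig_poly_continuous hq).
    by apply: (@continuous_comp _ _ _ sin (d 0%N)); [exact: continuous_sin|exact: cd].
  by move=> eta hd j x _; rewrite normrM mulrC ler_pM// hd// sin_max.
have [C1 C10 H1] := IH _ _ (trig_poly_mul_cos hq).
have [dq tq'] := trig_poly_derive hq.
have [C2 C20 H2] := IH _ _ tq'.
have [C3 C30 qC] := trig_poly_bounded hq.
exists (C1 + C2 + C3); first by rewrite !addr_ge0.
move=> d chd cd.
have chSd : derivative_chain k (fun j => d j.+1) by move=> j x jk; exact: chd.
have chd' : derivative_chain k d by move=> j x jk; apply: chd; exact: leqW.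
have [D1 [D10 chD1 cD1 bD1]] := H1 _ chSd cd.
have [D2 [D20 chD2 cD2 bD2]] := H2 _ chd' (continuous_derivative_chain chd cd (leqnSn k)).
exists (fun j => if j is j'.+1 then D1 j' \+ D2 j' else (fun x => d 0%N (sin x) * q x)).
split=> //.
- move=> [|j] x jk; last first.
    exact: is_deriveD (chD1 j x jk) (chD2 j x jk).
  have h1 := @is_derive1_comp R (d 0%N) sin x _ _ (chd 0%N (sin x) jk) (is_derive_sin x).
  have h := is_deriveM h1 (dq x).
  by apply: is_derive_eq; rewrite D10 D20 /GRing.scale /=; ring.
- by move=> x; apply: cvgD; [exact: cD1|exact: cD2].
move=> eta hd [|j] x jk.
  rewrite normrM; have eta0 : 0 <= eta by apply: le_trans (hd 0%N 0 _ _); rewrite ?normr0.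
  apply: (@le_trans _ _ (C3 * eta)); last by rewrite ler_wpM2r// lerDr addr_ge0.
  by rewrite mulrC ler_pM// hd// sin_max.
have b1 := bD1 eta (fun i t ik => hd i.+1 t ik) j x jk.
have b2 := bD2 eta (fun i t ik => hd i t (leqW ik)) j x jk.
have eta0 : 0 <= eta by apply: le_trans (hd 0%N 0 _ _); rewrite ?normr0.
apply: le_trans (ler_normD _ _) _.
have := mulr_ge0 C30 eta0; lra.
Qed.

Lemma trig_poly_sin_pow m : trig_poly m.+1 (fun x : R => sin x ^+ m).
Proof.
elim: m => [|m IH]; first exact: trig_poly_cst.
under [X in trig_poly _ X]eq_fun do rewrite exprSr.
exact: trig_poly_mul_sin.
Qed.

(** One derivative turns [sin x ^ (m + 1) q(x)] into [sin x ^ m q1(x)] with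
    [q1(0) = (m + 1) q(0)]. The weight [q] is there for this induction. *)
Lemma derive1n_sin_pow_mul m n q : trig_poly n q ->
  derive1n m (fun x => sin x ^+ m * q x) 0 = m`!%:R * q 0.
Proof.
elim: m n q => [|m IH] n q hq; first by rewrite /= expr0.
have [dq tq'] := trig_poly_derive hq.
rewrite /derive1n iterSr -/(derive1n m _).
pose q1 x := m.+1%:R * (q x * cos x) + derive1 q x * sin x.
have tq1 : trig_poly n.+1 q1.
  by apply: trig_polyD; [apply: trig_polyZ; exact: trig_poly_mul_cos|exact: trig_poly_mul_sin].
have -> : derive1 (fun x => sin x ^+ m.+1 * q x) = (fun x => sin x ^+ m * q1 x).
  apply/funext => x; rewrite derive1E.
  have h1 := @is_deriveX R _ sin m.+1 x 1 _ (is_derive_sin x).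
  have h := is_deriveM h1 (dq x).
  have -> : (fun x => sin x ^+ m.+1 * q x) = sin ^+ m.+1 * q.
    by apply/funext => u; rewrite /GRing.mul /= exprfctE.
  case: h => _ ->; rewrite /q1 /GRing.scale /= exprfctE exprS; ring.
by rewrite (IH _ _ tq1) /q1 sin0 cos0 mulr0 addr0 mulr1 mulrA -natrM mulnC -factS.
Qed.

End composition_with_sine.
(** * Collections generated by one period *)

Section periodic_collections.
Context {R : realType}.
Implicit Types (f : R -> R) (b : nat -> R) (q : int).

Lemma periodic_int f : periodic f (pi *+ 2) ->
  forall x q, f (x + pi *+ 2 * q%:~R) = f x.
Proof.
move=> pf x [n|n].
  by rewrite -pmulrn mulr_natr periodicn.
by rewrite NegzE mulrNz -pmulrn mulrN mulr_natr -(periodicn pf n.+1) subrK.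
Qed.

(** The values of [b] on [0, ..., 2s - 1] are one period of the collection. The
    lemmas below ask that [b (2s)] be [b 0 + 2 pi], so that consecutive points are
    treated uniformly, also at the end of a period. *)
Definition periodic_collection s b : int -> R := fun i =>
  b `|(i %% (2 * s)%:Z)%Z|%N + pi *+ 2 * ((i %/ (2 * s)%:Z)%Z)%:~R.

Lemma periodic_collectionE s b q j : (j < 2 * s)%N ->
  periodic_collection s b (q * (2 * s)%:Z + j%:Z) = b j + pi *+ 2 * q%:~R.
Proof.
move=> js; rewrite /periodic_collection modzMDl modz_nat modn_small//.
rewrite divzMDl; last by rewrite eqz_nat; move: js; lia.
by rewrite divz_nat divn_small// addr0.
Qed.

Lemma int_block_split s (i : int) : (0 < s)%N ->
  exists q j, (j < 2 * s)%N /\ i = q * (2 * s)%:Z + j%:Z.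
Proof.
move=> s0; exists (i %/ (2 * s)%:Z)%Z, `|(i %% (2 * s)%:Z)%Z|%N.
have d0 : (2 * s)%:Z != 0 by lia.
split; last by rewrite gez0_abs ?modz_ge0// -divz_eq.
by have := ltz_pmod i (_ : 0 < (2 * s)%:Z); lia.
Qed.

Lemma periodic_collection_succ s b q j : (j < 2 * s)%N ->
  b (2 * s)%N = b 0%N + pi *+ 2 ->
  periodic_collection s b (q * (2 * s)%:Z + j%:Z + 1) = b j.+1 + pi *+ 2 * q%:~R.
Proof.
move=> js b2s; have [js1|js1] := ltnP j.+1 (2 * s).
  by rewrite -addrA -[j%:Z + 1]/(j + 1)%:Z addn1 periodic_collectionE.
have e : j.+1 = (2 * s)%N by lia.
have -> : q * (2 * s)%:Z + j%:Z + 1 = (q + 1) * (2 * s)%:Z + 0%:Z by lia.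
by rewrite periodic_collectionE ?e ?b2s ?intrD; [ring|lia].
Qed.

Lemma collection_periodic_collection s b : (0 < s)%N ->
  (forall j, (j < 2 * s)%N -> b j < b j.+1) -> b (2 * s)%N = b 0%N + pi *+ 2 ->
  collection s (periodic_collection s b).
Proof.
move=> s0 bS b2s i; have [q [j [js ->]]] := int_block_split i s0.
split; first by rewrite periodic_collection_succ// periodic_collectionE// ltrD2r bS.
have -> : q * (2 * s)%:Z + j%:Z + (2 * s)%:Z = (q + 1) * (2 * s)%:Z + j%:Z by ring.
by rewrite !periodic_collectionE// intrD; ring.
Qed.

(** A period contains an even number [2s] of points, so shifting the index by a
    period preserves the sign [(-1) ^ (i - 1)]. *)
Lemma Delta1_periodic_collection s b f : (0 < s)%N ->
  b (2 * s)%N = b 0%N + pi *+ 2 -> C0_2pi f ->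
  (forall j, (j < 2 * s)%N -> {in `[b j, b j.+1] &,
    {homo (fun x => (-1) ^+ j * f x) : x y / x <= y}}) ->
  Delta1 (periodic_collection s b) f.
Proof.
move=> s0 b2s Cf mf; split=> // i.
have [q [j [js iE]]] := int_block_split (i - 1) s0.
have iE' : i = q * (2 * s)%:Z + j%:Z + 1 by rewrite -iE subrK.
rewrite iE {1}iE' periodic_collectionE// periodic_collection_succ// => x y.
have -> : (-1 : R) ^ (q * (2 * s)%:Z + j%:Z) = (-1) ^+ j.
  rewrite expfzDr ?oppr_eq0 ?oner_eq0// mulrC (mulrC q) -exprz_exp.
  have -> : (-1 : R) ^ (2 * s)%:Z = 1.
    by rewrite -exprnP exprM sqrrN expr1n expr1n.
  by rewrite exp1rz mulr1.
rewrite !in_itv /= => /andP[x1 x2] /andP[y1 y2] xy.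
have fE z : f z = f (z - pi *+ 2 * q%:~R).
  by rewrite -[in RHS](periodic_int Cf.2 _ q) subrK.
rewrite (fE x) (fE y); apply: (mf j js).
- by rewrite in_itv /= lerBrDr lerBlDr x1 x2.
- by rewrite in_itv /= lerBrDr lerBlDr y1 y2.
- by rewrite lerD2r.
Qed.

End periodic_collections.

(** * The flattened power of a sine *)

Section flattened_power.
Context {R : realType}.
Implicit Types (e x : R) (r : nat).

(** The power [sin x ^ (r + 1)] with [r] odd has four extrema in a period, whereas
    with the half-angle it has only two, at [0] and [pi]. For [r] even the half-angle
    would destroy the period [2 pi]. *)
Definition frequency r : R := if odd r then 2^-1 else 1.

(** For [e = 0] this is the trigonometric polynomial [sin (a x) ^ (r + 1)]; for [e > 0]
    the threshold makes it vanish identically near [0]. *)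
Definition flat_power e r x : R := soft_threshold e (sin (frequency r * x)) ^+ r.+1.

Lemma frequency_gt0 r : 0 < frequency r.
Proof. by rewrite /frequency; case: odd => //; rewrite invr_gt0. Qed.

Lemma frequency_le1 r : frequency r <= 1.
Proof. by rewrite /frequency; case: odd => //; lra. Qed.

Lemma flat_power0 r x : flat_power 0 r x = sin (frequency r * x) ^+ r.+1.
Proof. by rewrite /flat_power soft_threshold0. Qed.

Lemma flat_power_periodic e r : 0 <= e -> periodic (flat_power e r) (pi *+ 2).
Proof.
move=> e0 x; rewrite /flat_power /frequency.
case: ifPn => o; last by rewrite mulrDr !mul1r sinD2pi.
have -> : 2^-1 * (x + pi *+ 2) = 2^-1 * x + pi by rewrite mulr2n; field.
rewrite sinDpi.
have -> t : soft_threshold e (- t) = - soft_threshold e t.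
  by rewrite /soft_threshold opprK opprB.
by rewrite exprNn -signr_odd /= o mul1r.
Qed.

Lemma flat_power_norm_le1 e r x : 0 <= e -> `|flat_power e r x| <= 1.
Proof.
move=> e0; rewrite normrX exprn_ile1//.
exact: le_trans (soft_threshold_norm_le _ e0) (sin_max _).
Qed.

Lemma sin_norm_le x : `|sin x| <= `|x| :> R.
Proof.
have := @derive_lipschitz R sin cos 1 (@is_derive_sin R) (@cos_max R) 0 x.
by rewrite sin0 !subr0 mul1r.
Qed.

Lemma flat_power_eq0 e r x : `|x| <= e -> flat_power e r x = 0.
Proof.
move=> xe; rewrite /flat_power soft_threshold_mid ?expr0n//.
apply: le_trans (sin_norm_le _) _; rewrite normrM gtr0_norm ?frequency_gt0//.
by apply: le_trans xe; rewrite ler_piMl// frequency_le1.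
Qed.

(** For [r] odd, [sin (x / 2) ^ 2 = (1 - cos x) / 2]. *)
Lemma trig_poly_flat_power0 r : trig_poly r.+2 (flat_power 0 r).
Proof.
have -> : flat_power 0 r = fun x => sin (frequency r * x) ^+ r.+1.
  by apply/funext => x; rewrite flat_power0.
rewrite /frequency; case: ifPn => o; last first.
  by under [X in trig_poly _ X]eq_fun do rewrite mul1r; exact: trig_poly_sin_pow.
have [m mE] : exists m, r.+1 = (2 * m)%N by exists (r.+1)./2; lia.
apply: (@trig_poly_mono _ m.+1); first by lia.
have -> : (fun x : R => sin (2^-1 * x) ^+ r.+1) = fun x => ((1 - cos x) / 2) ^+ m.
  apply/funext => x; rewrite mE exprM; congr (_ ^+ _).
  have {2}-> : x = (2^-1 * x) *+ 2 by rewrite mulr2n; field.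
  by rewrite cos_mulr2n cos2sin2 mulr2n; field.
elim: m {mE} => [|m IH]; first by rewrite /=; exact: trig_poly_cst.
have -> : (fun x : R => ((1 - cos x) / 2) ^+ m.+1) = fun x =>
    2^-1 * (((1 - cos x) / 2) ^+ m - ((1 - cos x) / 2) ^+ m * cos x).
  by apply/funext => x; rewrite exprS; ring.
apply: trig_polyZ; apply: trig_polyB; first exact: trig_poly_mono IH.
exact: trig_poly_mul_cos.
Qed.

(** At [0] the derivative of order [r + 1] is [a ^ (r + 1) (r + 1)!]; continuity
    extends the positivity to a neighbourhood. *)
Lemma flat_power0_derive r : exists c e0 : R, [/\ 0 < c, 0 < e0 &
  forall x, `|x| <= e0 -> c <= derive1n r.+1 (flat_power 0 r) x].
Proof.
have h0 : 0 < derive1n r.+1 (flat_power 0 r) 0.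
  have ch := derivative_chain_scale (frequency r)
    (trig_poly_chain (trig_poly_sin_pow r.+1) (k := r.+1)).
  have := derivative_chain_derive1n ch (leqnn r.+1).
  have -> : (fun x => frequency r ^+ 0 * derive1n 0 (fun x : R => sin x ^+ r.+1) (frequency r * x))
    = flat_power 0 r.
    by apply/funext => x; rewrite /= expr0 mul1r flat_power0.
  move=> ->; rewrite mulr0.
  have -> : derive1n r.+1 (fun x : R => sin x ^+ r.+1) 0 = (r.+1)`!%:R * 1.
    rewrite -(derive1n_sin_pow_mul r.+1 (trig_poly_cst (n := 1) 1 isT)).
    by congr (derive1n _ _ 0); apply/funext => x; rewrite mulr1.
  by rewrite mulr1 mulr_gt0 ?exprn_gt0 ?frequency_gt0// ltr0n fact_gt0.
set g := derive1n _ _ in h0 *.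
have : g x @[x --> (0 : R)] --> g 0.
  exact: (trig_poly_continuous (trig_poly_derive1n r.+1 (trig_poly_flat_power0 r))).
move=> /cvgrPdist_lt /(_ (g 0 / 2)) /(_ (divr_gt0 h0 (ltr0n _ 2))).
move=> [e0 /= e00 he]; exists (g 0 / 2), (e0 / 2); split; rewrite ?divr_gt0// => x xe.
have : `|g 0 - g x| < g 0 / 2.
  by apply: he; rewrite /= sub0r normrN; apply: le_lt_trans xe _; lra.
by rewrite ltr_norml => /andP[? ?]; lra.
Qed.

(** As [e] tends to [0], the derivatives of order at most [r] converge uniformly to
    those of the trigonometric polynomial, at a linear rate. *)
Lemma flat_power_chain r : exists2 C : R, 0 <= C & forall e, 0 <= e ->
  exists D, [/\ D 0%N = flat_power e r, derivative_chain r D, continuous (D r) &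
    forall j x, (j <= r)%N -> `|D j x - derive1n j (flat_power 0 r) x| <= C * e].
Proof.
have [C C0 HC] := comp_sin_chain r (trig_poly_cst (n := 1) (1 : R) isT).
exists (C * ((r.+1)`!%:R * r.+1%:R)); first by rewrite !mulr_ge0.
move=> e e0.
pose d j (t : R) := soft_power e r.+1 j t - soft_power 0 r.+1 j t.
have chd : derivative_chain r d.
  by move=> j x jr; exact: is_deriveB (soft_power_chain e0 x jr)
    (soft_power_chain (lexx 0) x jr).
have cd : continuous (d r).
  by move=> x; apply: cvgB; exact: continuous_soft_power.
have [D [D0 chD cD bD]] := HC d chd cd.
have F0c := trig_poly_chain (trig_poly_flat_power0 r) (k := r).
have Dc := derivative_chain_scale (frequency r) chD.
exists (fun j => (fun x => frequency r ^+ j * D j (frequency r * x)) \+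
  derive1n j (flat_power 0 r)); split.
- apply/funext => x; rewrite /= expr0 mul1r D0 /d /soft_power mulr1 ffactn0 subn0 !mul1r.
  by rewrite soft_threshold0 flat_power0 subrK.
- by move=> j x jr; exact: is_deriveD (Dc j x jr) (F0c j x jr).
- move=> x; apply: cvgD; last first.
    exact: (trig_poly_continuous (trig_poly_derive1n r (trig_poly_flat_power0 r))).
  apply: cvgM; first exact: cvg_cst.
  apply: (@continuous_comp _ _ _ (fun y => frequency r * y) (D r)); last exact: cD.
  exact: mulrl_continuous.
move=> j x jr; rewrite /= addrK normrM.
have {}bD : forall j x, (j <= r)%N -> `|D j x| <= C * ((r.+1)`!%:R * r.+1%:R * e).
  apply: bD => i t ir t1; apply: le_trans (soft_power_dist _ _ e0 t1) _.
  rewrite ler_wpM2r// ler_wpM2r// ler_nat.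
  by rewrite -(@ffact_fact r.+1 i) ?leq_pmulr ?fact_gt0// leqW.
rewrite -[X in _ <= X]mulrA; apply: le_trans (bD j (frequency r * x) jr).
rewrite ler_piMl// normrX exprn_ile1// gtr0_norm ?frequency_gt0//.
exact: frequency_le1.
Qed.

(** From [left_end] to [right_end] the flattened power increases, and from
    [right_end] to the end of the period it decreases. *)
Definition left_end r : R := if odd r then 0 else - (pi / 2).
Definition right_end r : R := if odd r then pi else pi / 2.

Lemma ler_odd_pow m : odd m -> {homo (fun x : R => x ^+ m) : x y / x <= y}.
Proof.
move=> om x y xy; have [x0|x0] := leP 0 x.
  by rewrite lerXn2r ?nnegrE// (le_trans x0).
have [y0|y0] := leP 0 y.
  by apply: (@le_trans _ _ 0); rewrite ?exprn_ge0// exprn_odd_le0// ltW.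
rewrite -lerN2 -!(mulN1r (_ ^+ m)) -[X in X * _ <= _]expr1 -[X in _ <= X * _]expr1.
rewrite -[1%N]/(nat_of_bool true) -om !signr_odd -!exprNn.
by rewrite lerXn2r ?nnegrE ?lerN2// oppr_ge0 ltW.
Qed.

Lemma le_sin_pihalf : {in `[- (pi / 2), pi / 2 : R] &, {homo sin : x y / x <= y}}.
Proof.
move=> x y xI yI; rewrite le_eqVlt => /orP[/eqP->//|xy].
by rewrite ltW// ltr_sin.
Qed.

Lemma flat_power_homo e r : 0 <= e ->
  {in `[left_end r, right_end r] &, {homo flat_power e r : x y / x <= y}}.
Proof.
move=> e0 x y; rewrite /left_end /right_end /flat_power /frequency !in_itv /=.
have p0 := pi_gt0 R; case: ifPn => o /andP[x1 x2] /andP[y1 y2] xy.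
  rewrite lerXn2r ?nnegrE ?soft_threshold_ge0//; try by apply: sin_ge0_pi; lra.
  by apply: le_soft_threshold => //; apply: le_sin_pihalf; rewrite ?in_itv /=; lra.
apply: ler_odd_pow => //; apply: le_soft_threshold => //.
by apply: le_sin_pihalf; rewrite ?in_itv /= ?mul1r ?x1 ?x2 ?y1 ?y2.
Qed.

(** The graph is symmetric about [right_end], where the sine has its maximum; this
    reduces the decreasing half of a period to the increasing one. *)
Lemma flat_power_reflect e r x : flat_power e r (right_end r *+ 2 - x) = flat_power e r x.
Proof.
rewrite /flat_power; congr (soft_threshold _ _ ^+ _).
have -> : frequency r * (right_end r *+ 2 - x) = pi - frequency r * x.
  by rewrite /frequency /right_end mulr2n; case: odd; field.
by rewrite sinB sinpi cospi; ring.
Qed.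

Lemma flat_power_nhomo e r : 0 <= e ->
  {in `[right_end r, left_end r + pi *+ 2] &, {homo flat_power e r : x y /~ x <= y}}.
Proof.
move=> e0 x y; rewrite !in_itv /= => /andP[x1 x2] /andP[y1 y2] xy.
rewrite -(flat_power_reflect e r x) -(flat_power_reflect e r y).
have E : left_end r = right_end r *+ 2 - (left_end r + pi *+ 2).
  by rewrite /left_end /right_end !mulr2n; case: odd; field.
by apply: flat_power_homo => //; rewrite ?in_itv /=; lra.
Qed.

(** All points but the extrema outside the flat region are crowded into [[0, e]]. For
    [r] even these extrema are [- pi / 2] and [pi / 2]; for [r] odd the only one is
    [pi], and the point of index [0] is itself in the flat region. *)
Definition cluster s r e (j : nat) : R :=
  if j == 0%N then left_end r
  else if (j < (2 * s).-1)%N then e * (j%:R / (2 * s)%:R)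
  else if j == (2 * s).-1 then right_end r else left_end r + pi *+ 2.

Lemma left_end_le0 r : left_end r <= 0.
Proof. by rewrite /left_end; have := pi_gt0 R; case: odd => // *; lra. Qed.

Lemma right_end_ge1 r : 1 <= right_end r.
Proof.
rewrite /right_end; have := pihalf_ge1 R; have := pi_gt0 R.
by case: odd => // *; lra.
Qed.

Lemma right_end_lt r : right_end r < left_end r + pi *+ 2.
Proof.
rewrite /right_end /left_end -[pi *+ 2]mulr_natl; have := pi_gt0 R.
by case: odd => // p0; lra.
Qed.

Section cluster_properties.
Variables (s r : nat) (e : R).
Hypotheses (s2 : (2 <= s)%N) (e_gt0 : 0 < e) (e_le1 : e <= 1).

Lemma cluster_mid j : (0 < j < (2 * s).-1)%N ->
  cluster s r e j = e * (j%:R / (2 * s)%:R) /\ 0 < cluster s r e j < e.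
Proof.
clear e_le1; move=> /andP[j0 js]; rewrite /cluster gtn_eqF// js; split=> //.
have s0 : 0 < (2 * s)%:R :> R by rewrite ltr0n; lia.
rewrite mulr_gt0 ?divr_gt0 ?ltr0n//=; last by move: s2; lia.
rewrite gtr_pMr// ltr_pdivrMr// mul1r ltr_nat; lia.
Qed.

Lemma cluster_last : cluster s r e (2 * s).-1 = right_end r.
Proof. by clear e_gt0 e_le1; rewrite /cluster ltnn eqxx gtn_eqF//; lia. Qed.

Lemma cluster_period : cluster s r e (2 * s) = cluster s r e 0 + pi *+ 2.
Proof.
clear e_gt0 e_le1; rewrite /cluster eqxx gtn_eqF; last by lia.
rewrite ltnNge leq_pred /= gtn_eqF//; lia.
Qed.

Lemma cluster_incr j : (j < 2 * s)%N -> cluster s r e j < cluster s r e j.+1.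
Proof.
move=> js.
have lz : cluster s r e 0 <= 0 by exact: left_end_le0.
have [->|j0] := eqVneq j 0%N.
  have [_ /andP[h _]] := @cluster_mid 1 (ltac:(move: s2; lia)).
  exact: le_lt_trans lz h.
have [j1|j1] := ltnP j (2 * s).-1; last first.
  have -> : j = (2 * s).-1 by lia.
  rewrite cluster_last prednK; last by lia.
  by rewrite cluster_period; exact: right_end_lt.
have jm : (0 < j < (2 * s).-1)%N by lia.
have [E1 /andP[_ le]] := cluster_mid jm.
have [j2|j2] := ltnP j.+1 (2 * s).-1.
  have jm2 : (0 < j.+1 < (2 * s).-1)%N by lia.
  have [-> _] := cluster_mid jm2; rewrite E1 ltr_pM2l// ltr_pM2r ?ltr_nat//.
  by rewrite invr_gt0 ltr0n; lia.
have -> : j.+1 = (2 * s).-1 by lia.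
rewrite cluster_last; apply: lt_le_trans le (le_trans e_le1 (right_end_ge1 r)).
Qed.

Lemma le_cluster j1 j2 : (j1 <= j2)%N -> (j2 <= 2 * s)%N ->
  cluster s r e j1 <= cluster s r e j2.
Proof.
elim: j2 => [|j2 IH]; first by rewrite leqn0 => /eqP->.
rewrite leq_eqVlt => /orP[/eqP->//|j12] j2s.
exact: le_trans (IH j12 (ltnW j2s)) (ltW (cluster_incr j2s)).
Qed.

Lemma periodic_cluster_mid (j : nat) : (0 < j < (2 * s).-1)%N ->
  0 < cluster s r e j < e /\ periodic_collection s (cluster s r e) j = cluster s r e j.
Proof.
move=> jm; have [_ h] := cluster_mid jm; split=> //.
have := @periodic_collectionE R s (cluster s r e) 0 j.
by rewrite mul0r add0r mulr0 addr0; apply; clear -jm; lia.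
Qed.

(** The odd indices below [2s - 1] are those where a decrease is required although
    the sine increases; the corresponding intervals lie in [[0, e]], where the function
    is constant. *)
Lemma Delta1_flat_power : C0_2pi (flat_power e r) ->
  Delta1 (periodic_collection s (cluster s r e)) (flat_power e r).
Proof.
move=> CF; apply: Delta1_periodic_collection => //; first by move: s2; lia.
  exact: cluster_period.
move=> j js.
have sub_incr : (j < (2 * s).-1)%N -> {in `[cluster s r e j, cluster s r e j.+1] &,
    {homo flat_power e r : x y / x <= y}}.
  move=> js1; have sub z : z \in `[cluster s r e j, cluster s r e j.+1] ->
      z \in `[left_end r, right_end r].
    rewrite !in_itv /= -cluster_last -[left_end r]/(cluster s r e 0) => /andP[z1 z2].
    apply/andP; split.
      by apply: le_trans z1; apply: le_cluster => //; exact: ltnW.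
    by apply: (le_trans z2); apply: le_cluster => //; exact: leq_pred.
  by move=> x y /sub xI /sub yI; exact: flat_power_homo (ltW e_gt0) _ _ xI yI.
have [oj|oj] := boolP (odd j); last first.
  move=> x y xI yI xy; rewrite -signr_odd (negbTE oj) expr0 !mul1r.
  by apply: sub_incr => //; move: js oj; lia.
move=> x y xI yI xy; rewrite -signr_odd oj expr1 !mulN1r lerN2.
have [js1|js1] := ltnP j (2 * s).-1.
  have flat z : z \in `[cluster s r e j, cluster s r e j.+1] -> flat_power e r z = 0.
    have jm : (0 < j < (2 * s).-1)%N by move: js1 oj; lia.
    have jm1 : (0 < j.+1 < (2 * s).-1)%N by move: js1 oj; lia.
    have [_ /andP[j0 _]] := cluster_mid jm; have [_ /andP[_ j1]] := cluster_mid jm1.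
    rewrite in_itv /= => /andP[z1 z2]; apply: flat_power_eq0; rewrite ler_norml.
    by apply/andP; split; lra.
  by rewrite !flat.
have jE : j = (2 * s).-1 by move: js js1; lia.
have jE1 : j.+1 = (2 * s)%N by move: js js1; lia.
move: xI yI; rewrite jE1 cluster_period jE cluster_last => xI yI.
exact: flat_power_nhomo (ltW e_gt0) _ _ yI xI xy.
Qed.

End cluster_properties.

End flattened_power.
(** * Lower bounds for comonotone approximation *)

Section lower_bound.
Context {R : realType}.
Implicit Types (F T : R -> R) (Y : int -> R).

Lemma le_E1 n F Y (m : R) : (0 < n)%N ->
  (forall T, trig_poly n T -> Delta1 Y T -> m <= max_norm (F \- T)) -> m <= E1 n F Y.
Proof.
move=> n0 h; apply: lb_le_inf; last by move=> _ [T [tT dT] <-]; exact: h.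
exists (max_norm (F \- (fun=> 0))), (fun=> 0) => //; split; first exact: trig_poly0.
split; first by split=> [x|x]; [exact: cst_continuous|].
by move=> i x y _ _ _; rewrite !mulr0.
Qed.

(** The derivative of order [r + 1] of [T] vanishes somewhere between the first and
    the last of the [r + 1] points, where the one of [F] is at least [c]. Bernstein's
    inequality for [F - T], whose degree is less than [(r + 2) n], turns this gap into
    a uniform distance. *)
Lemma cluster_lower_bound s r n Y T F (c e0 B : R) : (0 < n)%N ->
  collection s Y -> (forall j : nat, (j <= r)%N -> `|Y j.+1| <= e0) ->
  trig_poly n T -> Delta1 Y T -> trig_poly r.+2 F ->
  (forall x, `|x| <= e0 -> c <= derive1n r.+1 F x) ->
  (forall x, `|F x - T x| <= B) ->
  c <= (2 * r.+2%:R) ^+ r.+1 * n%:R ^+ r.+1 * B.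
Proof.
move=> n0 cY Ye tT dT tF cF bB.
have chT : derivative_chain r (fun j => derive1n j.+1 T).
  move=> j x jr; exact: (trig_poly_chain (k := r.+1) tT).
have [xi /andP[xi1 xi2] xi0] : exists2 xi, Y 1%N <= xi <= Y r.+1 & derive1n r.+1 T xi = 0.
  apply: (derivative_chain_rolle (z := fun j => Y j.+1) chT) => j jr.
    have [h _] := cY j.+1; move: h.
    by rewrite -[j.+1%:Z + 1]/(j.+1 + 1)%:Z addn1.
  apply: (Delta1_derive_eq0 _ cY dT) => x.
  by have [h _] := trig_poly_derive tT; case: (h x).
have xie : `|xi| <= e0.
  have := Ye 0%N isT; have := Ye r (leqnn r); rewrite !ler_norml.
  by move=> /andP[? ?] /andP[? ?]; lra.
have N1 : (r.+2 <= r.+2 * n)%N by rewrite leq_pmulr.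
have N2 : (n <= r.+2 * n)%N by rewrite leq_pmull.
have tF' := trig_poly_mono N1 tF; have tT' := trig_poly_mono N2 tT.
have := bernstein_derive1n r.+1 (trig_polyB tF' tT') bB xi.
have -> : derive1n r.+1 (fun x => F x - T x) xi = derive1n r.+1 F xi.
  rewrite -[RHS]subr0 -[X in _ = _ - X]xi0.
  by rewrite -[LHS]/(derive1n r.+1 (F \- T) xi) (trig_poly_derive1nB r.+1 tF' tT').
move=> h.
apply: le_trans (cF xi xie) _; apply: le_trans (ler_norm _) _.
by rewrite -exprMn -(mulrA 2) -natrM.
Qed.

End lower_bound.

(** * The extremal example *)

Section extremal_example.
Context {R : realType}.

(** The two sides are compared through the trigonometric polynomial [flat_power 0 r]:
    its distance to the comonotone polynomials is at least of the order
    [n ^ (- r - 1)], and [n ^ (1 - r)] times its second modulus at [1 / n] is at most of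
    that order. The width [e] of the cluster is chosen after [n], so small that
    flattening changes neither order. *)
Lemma flat_power_example (r : nat) :
  exists2 c : R, 0 < c & forall s n : nat, (r < 2 * s - 2)%N -> (1 <= n)%N ->
    exists Y F, [/\ collection s Y, Cr_2pi r F, Delta1 Y F &
      n%:R * (c / n%:R ^+ r) * omega 2 (derive1n r F) (1 / n%:R) < E1 n F Y].
Proof.
have [C C0 HC] := @flat_power_chain R r.
have [c0 [e0 [c0_gt0 e0_gt0 Hc]]] := @flat_power0_derive R r.
have tF0 := @trig_poly_flat_power0 R r.
have [M M0 HM] := trig_poly_bounded (trig_poly_derive1n r.+2 tF0).
pose K : R := (2 * r.+2%:R) ^+ r.+1.
have K0 : 0 < K by rewrite exprn_gt0// mulr_gt0// ltr0n.
pose c1 := c0 / K.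
have c1_gt0 : 0 < c1 by rewrite divr_gt0.
(* The modulus will be at most [(M + c1) / n ^ 2] and the distance at least
   [3 c1 / 4 / n ^ (r + 1)]; this [c] leaves room between [1 / 2] and [3 / 4]. *)
pose c := c1 / (2 * (M + c1)).
have Mc : 0 < M + c1 by rewrite ltr_wpDl.
have c_gt0 : 0 < c by rewrite divr_gt0// mulr_gt0.
exists c => // s n rs n1.
have n0 : 0 < n%:R :> R by rewrite ltr0n.
pose v : R := n%:R^-1.
have v0 : 0 < v by rewrite invr_gt0.
have v1 : v <= 1 by rewrite invf_le1// ler1n.
(* The error allowed for flattening: it must be small against [v ^ (r + 1)] in
   the lower bound and against [v ^ 2] in the modulus, for every [r]. *)
pose kap := c1 / 4 * v ^+ r.+2.
have kap0 : 0 < kap by rewrite mulr_gt0 ?divr_gt0 ?exprn_gt0.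
pose e := Num.min (Num.min 1 e0) (kap / (C + 1)).
have C1 : 0 < C + 1 by rewrite ltr_wpDl.
have e_gt0 : 0 < e by rewrite !lt_min ltr01 e0_gt0 divr_gt0.
have e_le1 : e <= 1 by rewrite !ge_min lexx.
have e_le0 : e <= e0 by rewrite !ge_min lexx orbT.
have Ce : C * e <= kap.
  apply: (@le_trans _ _ ((C + 1) * e)); first by rewrite ler_wpM2r ?lerDl// ltW.
  by rewrite mulrC -ler_pdivlMr// !ge_min lexx orbT.
have [D [D0 chD cD bD]] := HC e (ltW e_gt0).
have s2 : (2 <= s)%N by clear -rs; lia.
have s0 : (0 < s)%N by clear -rs; lia.
pose Y := periodic_collection s (cluster s r e).
pose F := flat_power e r.
have cF : continuous F by rewrite /F -D0; exact: continuous_derivative_chain chD cD _.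
have C0F : C0_2pi F by split=> //; exact: flat_power_periodic (ltW e_gt0).
have cY : collection s Y.
  apply: collection_periodic_collection => //; last exact: cluster_period.
  by move=> j; exact: cluster_incr.
have dF : derive1n r F = D r by rewrite /F -D0; exact: derivative_chain_derive1n chD _.
have bF j x : (j <= r)%N -> `|D j x - derive1n j (flat_power 0 r) x| <= kap.
  by move=> jr; apply: le_trans (bD j x jr) Ce.
exists Y, F; split=> //.
- split=> //; last by rewrite dF.
  by move=> k x kr; rewrite /F -D0; exact: derivative_chain_derive1n_derivable chD kr.
- exact: Delta1_flat_power.
have Yc (j : nat) : (j <= r)%N -> `|Y j.+1| <= e0.
  move=> jr; have js : (0 < j.+1 < (2 * s).-1)%N by clear -rs jr; lia.
  have [/andP[j0 j1] YE] := periodic_cluster_mid r s2 e_gt0 js.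
  by rewrite /Y YE gtr0_norm// (le_trans (ltW j1)).
have lower : c1 * v ^+ r.+1 - kap <= E1 n F Y.
  apply: le_E1 => // T tT dT.
  have [CT CT0 HT] := trig_poly_bounded tT.
  have bFT x : `|F x - T x| <= max_norm (F \- T).
    apply: (@le_max_norm R (F \- T) (1 + CT)) => y /=.
    apply: le_trans (ler_normB _ _) _; apply: lerD => //.
    exact: flat_power_norm_le1 (ltW e_gt0).
  have := @cluster_lower_bound R s r n Y T (flat_power 0 r) c0 e0 (max_norm (F \- T) + kap)
    n1 cY Yc tT dT tF0 Hc.
  have hb x : `|flat_power 0 r x - T x| <= max_norm (F \- T) + kap.
    have h1 := bFT x; have h2 := bF 0%N x (leq0n r); rewrite D0 -/F /= in h2.
    have -> : flat_power 0 r x - T x = (F x - T x) - (F x - flat_power 0 r x) by ring.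
    by apply: le_trans (ler_normB _ _) _; apply: lerD.
  move=> /(_ hb); rewrite -/K => hK.
  have -> : c1 * v ^+ r.+1 = c0 / (K * n%:R ^+ r.+1) by rewrite /c1 /v exprVn invfM mulrA.
  by rewrite lerBlDr ler_pdivrMr ?mulr_gt0 ?exprn_gt0// mulrC.
have upper : omega 2 (derive1n r F) (1 / n%:R) <= M * v ^+ 2 + 4 * kap.
  have iv : 0 < 1 / n%:R :> R by rewrite div1r.
  have d1 (x : R) : is_derive x 1 (derive1n r (flat_power 0 r)) (derive1n r.+1 (flat_power 0 r) x).
    exact: (trig_poly_chain (k := r.+1) tF0).
  have d2 (x : R) : is_derive x 1 (derive1n r.+1 (flat_power 0 r)) (derive1n r.+2 (flat_power 0 r) x).
    exact: (trig_poly_chain (k := r.+2) tF0).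
  have d3 x : `|derive1n r F x - derive1n r (flat_power 0 r) x| <= kap.
    by rewrite dF; exact: bF.
  by have := omega2_le iv d1 d2 HM d3; rewrite {2}div1r.
have nv : n%:R * v = 1 by rewrite mulfV// gt_eqF.
have c14 : 0 <= c1 / 4 by rewrite divr_ge0// ltW.
have kapE : kap <= c1 / 4 * v ^+ 2.
  by rewrite /kap; apply: ler_wpM2l => //; apply: ler_wiXn2l => //; exact: ltW.
have kapE1 : kap <= c1 / 4 * v ^+ r.+1.
  by rewrite /kap; apply: ler_wpM2l => //; apply: ler_wiXn2l => //; exact: ltW.
apply: lt_le_trans lower.
apply: (@le_lt_trans _ _ (c * (M + c1) * v ^+ r.+1)).
  have -> : n%:R * (c / n%:R ^+ r) = n%:R * c * v ^+ r by rewrite /v exprVn mulrA.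
  have -> : c * (M + c1) * v ^+ r.+1 = n%:R * c * v ^+ r * ((M + c1) * v ^+ 2).
    transitivity (n%:R * v * (c * (M + c1) * (v * v ^+ r))); last by rewrite expr2; ring.
    by rewrite nv mul1r exprS.
  apply: ler_wpM2l; last by apply: le_trans upper _; lra.
  exact: mulr_ge0 (mulr_ge0 (ler0n _ _) (ltW c_gt0)) (exprn_ge0 _ (ltW v0)).
have -> : c * (M + c1) = c1 / 2 by rewrite /c; field; rewrite gt_eqF.
have := mulr_gt0 c1_gt0 (exprn_gt0 r.+1 v0); lra.
Qed.

End extremal_example.

Unset Implicit Arguments.
Set Strict Implicit.

Theorem theorem2p8 (R : realType) (r : nat) :
  (exists c : R, 0 < c /\
    forall s : nat, (1 <= s)%N -> (r < 2 * s - 2)%N ->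
    forall n : nat, (1 <= n)%N ->
    exists (Y : int -> R) (F : R -> R),
      [/\ collection s Y, Cr_2pi r F, Delta1 Y F &
          E1 n F Y > n%:R * (c / n%:R ^+ r) * omega 2 (derive1n r F) (1 / n%:R)])
  /\
  (forall s : nat, (1 <= s)%N -> (r < 2 * s - 2)%N ->
    forall A N : R, 0 < A -> 0 < N ->
    exists (n : nat) (Y : int -> R) (F : R -> R),
      [/\ n%:R > N, collection s Y, Cr_2pi r F, Delta1 Y F &
          E1 n F Y > A / n%:R ^+ r * omega 2 (derive1n r F) (1 / n%:R)]).
Proof.
have [c c0 H] := @flat_power_example R r.
split; first by exists c; split=> // s _ rs n n1; exact: H.
move=> s _ rs A N A0 N0.
(* With [n > A / c] the factor [n c] of the first part exceeds [A]. *)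
pose n := (Num.trunc (Num.max N (A / c))).+1.
have : Num.max N (A / c) < n%:R by apply: truncnS_gt.
rewrite gt_max => /andP[nN nA].
have [Y [F [cY rF dF hE]]] := H s n rs isT.
exists n, Y, F; split=> //; apply: le_lt_trans hE.
rewrite ler_wpM2r ?omega_ge0// mulrA ler_wpM2r ?invr_ge0 ?exprn_ge0//.
by rewrite -ler_pdivrMr// ltW.
Qed.
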